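(* Let $n,r\ge 1$ be integers and let $s=\gcd(n+1,r+1)$. Then $$\operatorname{corank}(H_{I})=s-1=\operatorname{corank}(H_{II}).$$
   Context: $N_r$ is the $r\times r$ matrix with all entries on and above the diagonal equal to $-1$ and all entries below the diagonal equal to $0$; $M_r=-N_r^t$. For $r\times r$ integer matrices $A,M$ with $A^t=-A$, put $N=-M^t$ and let $H(A,M)$ be the $nr\times nr$ matrix of $n\times n$ blocks of size $r\times r$ with diagonal blocks $A$, all blocks above the diagonal equal to $M$ and all blocks below the diagonal equal to $N$. Then $H_{I}=H(M_r+N_r,\,M_r)$ (case ''Combined I'') and $H_{II}=H(M_r+N_r,\,N_r)$ (case ''Combined II''). The corank of a square matrix is the dimension of its kernel. *)

(* Defs.v *)
From mathcomp Require Import all_boot all_order all_algebra.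

Set Implicit Arguments.
Unset Strict Implicit.
Unset Printing Implicit Defensive.

Import GRing.Theory.
Local Open Scope ring_scope.

Definition Nmx (r : nat) : 'M[int]_r :=
  \matrix_(i < r, j < r) (if (i <= j)%N then -1 else 0).

Definition Mmx (r : nat) : 'M[int]_r := - (Nmx r)^T.

(* The dimension \sum_(i < n) r is the one imposed by \mxblock; it equals
   n * r by sum_nat_const and card_ord. H n A M is only meaningful for A
   antisymmetric, which is established below for the A that is used. *)
Definition H (n r : nat) (A M : 'M[int]_r) :
    'M[int]_(\sum_(i < n) r, \sum_(j < n) r) :=
  \mxblock_(i < n, j < n)
    (if i == j then A else if (i < j)%N then M else - M^T).

Definition H_I (n r : nat) := H n (Mmx r + Nmx r) (Mmx r).

Definition H_II (n r : nat) := H n (Mmx r + Nmx r) (Nmx r).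

(* kermx B represents {x | x *m B = 0}, so kermx B^T represents the kernel
   {v | B *m v = 0} acting on column vectors. The dimension is taken over the
   rationals, i.e. it is the rank of the kernel of A as a free Z-module. *)
Definition corank (m : nat) (A : 'M[int]_m) : nat :=
  \rank (kermx (map_mx intr A : 'M[rat]_m)^T).

Lemma trmx_MmxDNmx (r : nat) : (Mmx r + Nmx r)^T = - (Mmx r + Nmx r).
Proof. by rewrite /Mmx linearD linearN /= trmxK opprD opprK addrC [RHS]addrC addrC. Qed.

(* Main.v *)
Require Import Defs.
From mathcomp Require Import all_boot all_order all_algebra zify.

Set Implicit Arguments.
Unset Strict Implicit.
Unset Printing Implicit Defensive.

Import GRing.Theory.
Local Open Scope ring_scope.

(** In block coordinates x_{b,j} (b < n, j < r), the kernel of H_II consists of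
    the arrays for which, at every (a, i), the sum over the quadrant b <= a,
    j <= i equals the sum over b >= a, j >= i; reversing the order of the blocks
    gives the same description for H_I.  Mixed differences of these equations
    make x Toeplitz, x_{b,j} = D(n+j-b+1) - D(n+j-b), and the remaining equations
    say that D, a function on the n+r+2 integers [0, n+r+1], takes equal values
    at points n+1 or r+1 apart.  So D is invariant under the rotation by n+1
    modulo (n+1)+(r+1), that is, it is s-periodic.  Conversely every s-periodic D
    gives a solution, and D is determined by x up to an additive constant: the
    kernel has dimension s-1. *)

(** * Rotation invariance and periodic functions *)

(** Together the two hypotheses make [D] on [0, p+q) invariant under adding p modulo p+q: points k <
    q move to k+p, points k >= q to k-q. *)
Lemma rotation_invariant_gcd (T : Type) (p q : nat) (D : nat -> T) :
  (0 < p)%N -> (0 < q)%N ->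
  (forall k, k < q -> D (k + p) = D k)%N ->
  (forall k, k < p -> D (k + q) = D k)%N ->
  forall k, (k < p + q)%N -> D k = D (k %% gcdn p q)%N.
Proof.
move=> p0 q0 Dp Dq.
have pq0 : (0 < p + q)%N by lia.
have rot k : (k < p + q)%N -> D ((k + p) %% (p + q))%N = D k.
  move=> kpq; have [kq|qk] := ltnP k q; first by rewrite modn_small ?Dp //; lia.
  have -> : (k + p = (k - q) + (p + q))%N by lia.
  rewrite modnDr modn_small; last by lia.
  by rewrite -Dq ?subnK //; lia.
have rotn m k : (k < p + q)%N -> D ((k + m * p) %% (p + q))%N = D k.
  move=> kpq; elim: m => [|m IHm]; first by rewrite addn0 modn_small.
  rewrite mulSnr addnA -[RHS]IHm -[RHS]rot ?ltn_pmod //.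
  by rewrite modnDml.
have g0 : (0 < gcdn p q)%N by rewrite gcdn_gt0 p0.
have step k : (k + gcdn p q < p + q)%N -> D (k + gcdn p q)%N = D k.
  (* Bezout: p+q divides gcd + a*p, so [a] rotations by p carry k + gcd to k. *)
  move=> kg; have [a _ dva] := Bezoutl p pq0.
  rewrite -(rotn a) // -addnA; move: dva.
  rewrite [gcdn (p + q) p]gcdnC gcdnDl => /dvdnP[c ->].
  by rewrite addnC modnMDl modn_small //; lia.
move=> k; rewrite {1 2}(divn_eq k (gcdn p q)).
elim: (k %/ gcdn p q)%N => [|m IHm]; first by rewrite mul0n add0n.
by rewrite mulSnr addnAC => kpq; rewrite step // IHm //; lia.
Qed.

Lemma sum_period (V : nmodType) (p k : nat) (D : nat -> V) :
  (forall i, D (i + p)%N = D i) ->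
  \sum_(k <= i < k + p) D i = \sum_(0 <= i < p) D i.
Proof.
move=> Dp; elim: k => [//|k IHk]; rewrite -IHk.
case: p Dp {IHk} => [|p] Dp; first by rewrite !addn0 !big_geq.
rewrite addSn big_nat_recr /=; last by lia.
by rewrite Dp [RHS]big_ltn 1?addrC //; lia.
Qed.

(** * Arrays with equal opposite quadrant sums *)

(** Both closed quadrants contain the corner (a, i), whose two contributions cancel in the kernel
    equation. *)
Definition balanced (V : zmodType) (n r : nat) (y : nat -> nat -> V) :=
  forall a i, (a < n)%N -> (i < r)%N ->
    \sum_(0 <= b < a.+1) \sum_(0 <= j < i.+1) y b j =
    \sum_(a <= b < n) \sum_(i <= j < r) y b j.

Lemma balanced_transpose (V : zmodType) n r (y : nat -> nat -> V) :
  balanced n r y -> balanced r n (fun j b => y b j).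
Proof. by move=> yE i a ir an; rewrite exchange_big_nat /= yE // exchange_big_nat. Qed.

Lemma periodic_balanced (V : zmodType) n r (D : nat -> V) :
  (forall k, D (k + n.+1)%N = D k) -> (forall k, D (k + r.+1)%N = D k) ->
  balanced n r (fun b j => D (n + j - b).+1 - D (n + j - b)%N).
Proof.
move=> Dn Dr a i an ir.
have telD b u v : (b <= n)%N -> (u <= v)%N ->
  \sum_(u <= j < v) (D (n + j - b).+1 - D (n + j - b)%N) =
  D (n + v - b)%N - D (n + u - b)%N.
  move=> bn uv.
  rewrite (telescope_sumr_eq (fun j => D (n + j - b)%N)) // => j _.
  by congr (D _ - _); lia.
rewrite (eq_big_nat _ _ (F2 := fun b => D (n + i.+1 - b)%N - D (n - b)%N)); last first.
  by move=> b bn; rewrite telD ?addn0 //; lia.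
(* Period r+1 turns D(n+r-b) into D(n-(b+1)); writing both terms in b+1 prepares the shift of the
   range to [a+1, n+1). *)
rewrite [RHS](eq_big_nat _ _ (F2 := fun b => D (n - b.+1)%N - D (n + i.+1 - b.+1)%N)); last first.
  move=> b bn; rewrite telD; try lia.
  congr (_ - _); last by congr D; lia.
  rewrite -[RHS]Dr; congr D; lia.
rewrite !sumrB.
have shift (G : nat -> V) : \sum_(a <= b < n) G b.+1 = \sum_(a.+1 <= b < n.+1) G b.
  by rewrite big_add1.
rewrite (shift (fun b => D (n - b)%N)) (shift (fun b => D (n + i.+1 - b)%N)).
(* Moving the negative terms across glues the ranges: each side becomes a sum over 0 <= b <= n, a
   full window of length n+1. *)
apply/eqP; rewrite subr_eq addrAC eq_sym subr_eq; apply/eqP.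
rewrite addrC -!big_cat_nat //=; try lia.
transitivity (\sum_(0 <= b < n.+1) D b).
  by rewrite big_nat_rev /=; apply: eq_big_nat => b bn; congr D; lia.
rewrite -(sum_period i.+1 Dn) (big_addn 0 _ i.+1) addKn [RHS]big_nat_rev /=.
by apply: eq_big_nat => b bn; congr D; lia.
Qed.

(** From (a, i) to (a+1, i) the left quadrant gains a piece of row a+1 and the right one loses a
    piece of row a. *)
Lemma balanced_row (V : zmodType) n r (y : nat -> nat -> V) a i :
  balanced n r y -> (a.+1 < n)%N -> (i < r)%N ->
  \sum_(0 <= j < i.+1) y a.+1 j = - \sum_(i <= j < r) y a j.
Proof.
move=> yE an ir; have := yE a.+1 i an ir.
rewrite big_nat_recr //= yE //; last by lia.
rewrite (big_ltn (m := a)); last by lia.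
by move/eqP; rewrite -subr_eq0 addrAC addrK addrC addr_eq0 => /eqP.
Qed.

(** This is the difference of [balanced_row] at i+1 and at i. *)
Lemma balanced_toeplitz (V : zmodType) n r (y : nat -> nat -> V) a i :
  balanced n r y -> (a.+1 < n)%N -> (i.+1 < r)%N -> y a.+1 i.+1 = y a i.
Proof.
move=> yE an ir; have := balanced_row yE an ir.
rewrite big_nat_recr //= (balanced_row yE) //; last by lia.
rewrite (big_ltn (m := i)); last by lia.
by move/eqP; rewrite addrC subr_eq => /eqP->; rewrite addrCA addNr addr0.
Qed.

Lemma balanced_diagonal (V : zmodType) n r (y : nat -> nat -> V) b j :
  balanced n r y -> (b < n)%N -> (j < r)%N ->
  y b j = if (b <= j)%N then y 0%N (j - b)%N else y (b - j)%N 0%N.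
Proof.
move=> yE; elim: b j => [|b IHb] [|j] bn jr; rewrite ?subn0 //.
by rewrite (balanced_toeplitz yE) // IHb ?(ltnW bn) ?(ltnW jr).
Qed.

(* [d] lists the diagonals of [y], and its two extreme values are chosen so that
   every window of length [n.+1] or [r.+1] sums to zero; [D] is a primitive. *)
Lemma balanced_primitive (V : zmodType) n r (y : nat -> nat -> V) :
  (0 < n)%N -> (0 < r)%N -> balanced n r y ->
  exists D : nat -> V,
  [/\ forall b j, (b < n)%N -> (j < r)%N -> y b j = D (n + j - b).+1 - D (n + j - b)%N,
      forall k, (k < r.+1)%N -> D (k + n.+1)%N = D k &
      forall k, (k < n.+1)%N -> D (k + r.+1)%N = D k].
Proof.
move=> n0 r0 yE; have yTE := balanced_transpose yE.
pose d k := if k == 0%N then - \sum_(0 <= j < r) y n.-1 j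
  else if k == (n + r)%N then - \sum_(0 <= b < n) y b r.-1
  else if (k <= n)%N then y (n - k)%N 0%N else y 0%N (k - n)%N.
have dE b j : (b < n)%N -> (j < r)%N -> d (n + j - b)%N = y b j.
  move=> bn jr; rewrite (balanced_diagonal yE bn jr) /d.
  do 2 (rewrite ifF; last by apply/negbTE; lia).
  case: (ltngtP b j) => bj; last 1 first.
  - by rewrite ifT ?bj; [congr y; lia | lia].
  - by rewrite ifF; [congr y; lia | apply/negbTE; lia].
  - by rewrite ifT; [congr y; lia | lia].
(* In [d], row b fills a window of length r and column j, reversed, one of length n; the windows of
   length r+1 and n+1 add one neighbouring diagonal. *)
have rowE b : (b < n)%N ->
    \sum_(n - b <= k < n - b + r) d k = \sum_(0 <= j < r) y b j.
  move=> bn; rewrite -{1}[(n - b)%N]add0n big_addn addKn.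
  by apply: eq_big_nat => j jr; rewrite -dE //; congr d; lia.
have colE j : (j < r)%N ->
    \sum_(j.+1 <= k < j.+1 + n) d k = \sum_(0 <= b < n) y b j.
  move=> jr; rewrite -{1}[j.+1]add0n big_addn addKn [RHS]big_nat_rev /=.
  by apply: eq_big_nat => b bn; rewrite -dE; [congr d; lia | lia | lia].
have row0 b : (b.+1 < n)%N -> y b.+1 0%N = - \sum_(0 <= j < r) y b j.
  by move=> bn; rewrite -(balanced_row yE) // big_nat1.
have col0 j : (j.+1 < r)%N -> y 0%N j.+1 = - \sum_(0 <= b < n) y b j.
  by move=> jr; rewrite -(balanced_row yTE) // big_nat1.
have d0 : d 0%N = - \sum_(0 <= j < r) y n.-1 j by [].
have dnr : d (n + r)%N = - \sum_(0 <= b < n) y b r.-1.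
  by rewrite /d ifF ?ifT //; apply/negbTE; lia.
(* The value [d 0] must complete both the last row and the first column. The equation at (n-1, 0)
   makes these sums agree; [corner2] does the same for [d (n + r)]. *)
have corner1 : \sum_(0 <= j < r) y n.-1 j = \sum_(0 <= b < n) y b 0%N.
  have := yE n.-1 0%N; rewrite prednK // => /(_ (leqnn _) r0).
  have -> : \sum_(n.-1 <= b < n) \sum_(0 <= j < r) y b j = \sum_(0 <= j < r) y n.-1 j.
    by rewrite -{2}(prednK n0) big_nat1.
  by move<-; apply: eq_big_nat => b _; rewrite big_nat1.
have corner2 : \sum_(0 <= b < n) y b r.-1 = \sum_(0 <= j < r) y 0%N j.
  have := yTE r.-1 0%N; rewrite prednK // => /(_ (leqnn _) n0).
  have -> : \sum_(r.-1 <= j < r) \sum_(0 <= b < n) y b j = \sum_(0 <= b < n) y b r.-1.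
    by rewrite -{2}(prednK r0) big_nat1.
  by move<-; apply: eq_big_nat => b _; rewrite big_nat1.
have windown k : (k < r.+1)%N -> \sum_(k <= t < k + n.+1) d t = 0.
  case: k => [|k] kr.
    rewrite add0n big_ltn // d0 corner1 -(colE 0%N) // add1n.
    by rewrite addNr.
  rewrite addnS big_nat_recr /=; last by lia.
  rewrite colE //; have [krE|kr'] := eqVneq k.+1 r.
    have -> : (k.+1 + n = n + r)%N by lia.
    by rewrite dnr -krE subrr.
  have -> : d (k.+1 + n)%N = y 0%N k.+1 by rewrite -dE //; [congr d; lia | lia].
  by rewrite col0 ?subrr //; lia.
have windowr k : (k < n.+1)%N -> \sum_(k <= t < k + r.+1) d t = 0.
  move=> kn; have [->|k0] := eqVneq k n.
    rewrite addnS big_nat_recr /=; last by lia.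
    have := rowE 0%N n0; rewrite subn0 => ->.
    by rewrite dnr corner2 subrr.
  rewrite big_ltn; last by lia.
  have -> : d k = - \sum_(0 <= j < r) y (n - k.+1)%N j.
    case: k kn k0 => [|k] kn k0; first by rewrite d0 subn1.
    rewrite -row0; last by lia.
    by rewrite -dE; [congr d; lia | lia | lia].
  rewrite -rowE; last by lia.
  have -> : (n - (n - k.+1) = k.+1)%N by lia.
  by rewrite addnS addSn addNr.
pose D k := \sum_(0 <= t < k) d t.
have DB k m : D (k + m)%N = D k + \sum_(k <= t < k + m) d t.
  by rewrite /D -big_cat_nat //= leq_addr.
exists D; split=> [b j bn jr|k kr|k kn].
- by rewrite -dE // {1}/D big_nat_recr //= addrAC subrr add0r.
- by rewrite DB windown // addr0.
- by rewrite DB windowr // addr0.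
Qed.

(** The primitive is controlled only on [0, n+r+1]; reducing its argument modulo the gcd gives a
    function periodic everywhere. *)
Lemma balanced_periodic (V : zmodType) n r (y : nat -> nat -> V) :
  (0 < n)%N -> (0 < r)%N -> balanced n r y ->
  exists D : nat -> V,
    forall b j, (b < n)%N -> (j < r)%N ->
      y b j = D ((n + j - b).+1 %% gcdn n.+1 r.+1)%N -
              D ((n + j - b) %% gcdn n.+1 r.+1)%N.
Proof.
move=> n0 r0 /(balanced_primitive n0 r0)[D [yD Dn Dr]]; exists D => b j bn jr.
by rewrite yD // -!(rotation_invariant_gcd (q := r.+1) _ _ Dn Dr) //; lia.
Qed.

(** * The corank of a quadrant matrix *)

Lemma sum_box (F : nzSemiRingType) n r (y : nat -> nat -> F) u v w x :
  (v <= n)%N -> (x <= r)%N ->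
  \sum_(b < n) \sum_(j < r) y b j * ((u <= b < v)%N && (w <= j < x)%N)%:R =
  \sum_(u <= b < v) \sum_(w <= j < x) y b j.
Proof.
have restrict N s t (G : nat -> F) : (t <= N)%N ->
    \sum_(s <= k < t) G k = \sum_(k < N) (if (s <= k < t)%N then G k else 0).
  move=> tN; rewrite (big_nat_widen s t N) // (big_nat_widenl s 0) //= big_mkord.
  by rewrite -big_mkcond /=; apply: eq_bigl => k; rewrite andbC.
move=> vn xr; rewrite (restrict n) //; apply: eq_bigr => b _.
case: ifP => _ /=; last by rewrite big1 // => j _; rewrite mulr0.
rewrite (restrict r) //; apply: eq_bigr => j _.
by case: ifP; rewrite (mulr1, mulr0).
Qed.

(** The indexing [g] is left abstract so that one computation serves both matrices, whatever the
    order of their blocks. *)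
Lemma corank_quadrants n r m (K : 'M[int]_m) (g : 'I_n * 'I_r -> 'I_m) :
  (0 < n)%N -> (0 < r)%N -> bijective g ->
  (forall a b i j, K (g (a, i)) (g (b, j)) =
     ((b <= a)%N && (j <= i)%N)%:R - ((a <= b)%N && (i <= j)%N)%:R) ->
  corank K = (gcdn n.+1 r.+1).-1.
Proof.
case: n r g => [//|n] [//|r] g _ _ gbij KE; have [h gK hK] := gbij.
set s := gcdn n.+2 r.+2.
have sn : (s %| n.+2)%N by rewrite dvdn_gcdl.
have sr : (s %| r.+2)%N by rewrite dvdn_gcdr.
have s0 : (0 < s)%N by rewrite gcdn_gt0.
pose B : 'M[rat]_m := (map_mx intr K)^T.
pose y (v : 'rV[rat]_m) b j := v 0 (g (inord b, inord j)).
have kerP v : reflect (balanced n.+1 r.+1 (y v)) (v *m B == 0).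
  have vBE (a : 'I_n.+1) (i : 'I_r.+1) : (v *m B) 0 (g (a, i)) =
      \sum_(0 <= b < a.+1) \sum_(0 <= j < i.+1) y v b j -
      \sum_(a <= b < n.+1) \sum_(i <= j < r.+1) y v b j.
    rewrite -!(@sum_box _ n.+1 r.+1) // -sumrB mxE (reindex g) /=; last first.
      exact: onW_bij.
    rewrite (eq_bigr (fun p => v 0 (g (p.1, p.2)) * B (g (p.1, p.2)) (g (a, i)))); last by case.
    rewrite -(pair_bigA _ (fun b j => v 0 (g (b, j)) * B (g (b, j)) (g (a, i)))) /=.
    apply: eq_bigr => b _; rewrite -sumrB; apply: eq_bigr => j _.
    rewrite !mxE KE /y !inord_val -mulrBr rmorphB /= !rmorph_nat.
    by rewrite !ltnS !leq_ord !andbT.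
  apply: (iffP eqP) => [vB0 a i an ir|yE].
    have := vBE (Ordinal an) (Ordinal ir); rewrite vB0 mxE /= => /esym/eqP.
    by rewrite subr_eq0 => /eqP.
  apply/rowP => t; rewrite -(hK t); case: (h t) => a i.
  by rewrite vBE yE // subrr mxE.
(* The additive constant is fixed by D 0 = 0, leaving the values at 1, ..., s-1. *)
pose D (e : 'rV[rat]_s.-1) k := \sum_(l < s.-1) e 0 l * (k %% s == l.+1)%N%:R.
have Dmod e k : D e (k %% s)%N = D e k by rewrite /D modn_mod.
have D0 e : D e 0%N = 0 by rewrite /D big1 // => l _; rewrite mod0n mulr0.
have DS e (l : 'I_s.-1) : D e l.+1 = e 0 l.
  have ls : (l.+1 < s)%N by have := ltn_ord l; lia.
  rewrite /D (bigD1 l) //= modn_small // eqxx mulr1 big1 ?addr0 // => k kl.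
  by rewrite eqSS eq_sym val_eqE (negbTE kl) mulr0.
pose pos t := (n.+1 + (h t).2 - (h t).1)%N.
(* Row l is the array of differences of the s-periodic indicator of the residue l+1. *)
pose T : 'M[rat]_(s.-1, m) := \matrix_(l, t)
  (((pos t).+1 %% s == l.+1)%N%:R - (pos t %% s == l.+1)%N%:R).
have eT e t : (e *m T) 0 t = D e (pos t).+1 - D e (pos t).
  by rewrite mxE -sumrB; apply: eq_bigr => l _; rewrite mxE mulrBr.
have Tfree : row_free T.
  rewrite -kermx_eq0; apply/rowV0P => e /sub_kermxP eT0.
  have Dstep k : (0 < k < n.+1 + r.+1)%N -> D e k.+1 = D e k.
    (* Truncated subtraction picks an entry of diagonal k: in the first column if k <= n+1, in the
       first row otherwise. *)
    move=> k_bnd; pose b : 'I_n.+1 := inord (n.+1 - k); pose j : 'I_r.+1 := inord (k - n.+1).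
    have bE : b = (n.+1 - k)%N :> nat by rewrite inordK //; lia.
    have jE : j = (k - n.+1)%N :> nat by rewrite inordK //; lia.
    have := eT e (g (b, j)); rewrite eT0 mxE /pos gK /= bE jE => /esym/eqP.
    have -> : (n.+1 + (k - n.+1) - (n.+1 - k) = k)%N by lia.
    by rewrite subr_eq0 => /eqP.
  have Dconst k : (k < n.+1 + r.+1)%N -> D e k.+1 = D e 1%N.
    by elim: k => [//|k IHk] k_bnd; rewrite Dstep ?IHk //; lia.
  (* The constant is zero because s lies in the range and D(s) = D(0) = 0. *)
  have Dzero k : (k < n.+1 + r.+1)%N -> D e k.+1 = 0.
    have sle := dvdn_leq (ltn0Sn _) sn.
    move=> k_bnd; rewrite Dconst // -(Dconst s.-1); last by lia.
    by rewrite prednK // -Dmod modnn D0.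
  apply/rowP => l; rewrite -DS Dzero ?mxE //.
  by have sle := dvdn_leq (ltn0Sn _) sn; have := ltn_ord l; lia.
have -> : s.-1 = \rank T by apply/esym/eqP.
have Dper e d k : (s %| d)%N -> D e (k + d)%N = D e k.
  by move=> /dvdnP[c ->]; rewrite -Dmod addnC modnMDl Dmod.
apply/eqmx_rank/andP; split.
  apply/row_subP => i; set v := row i _.
  have /eqP/kerP vE : v *m B = 0 by rewrite /v -row_mul mulmx_ker row0.
  have [E yE] := balanced_periodic (ltn0Sn n) (ltn0Sn r) vE.
  (* Subtracting [E 0] normalises the primitive to vanish at 0; its values at 1, ..., s-1 are the
     coordinates. *)
  apply/submxP; exists (\row_l (E l.+1 - E 0%N)); set e := \row__ _.
  have DE k : D e k = E (k %% s)%N - E 0%N.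
    rewrite -Dmod; have := ltn_pmod k s0; case: (k %% s)%N => [_|l ls].
      by rewrite D0 subrr.
    have ls' : (l < s.-1)%N by lia.
    by rewrite (DS e (Ordinal ls')) mxE.
  apply/rowP => t; rewrite eT !DE opprB addrA subrK.
  have := yE (h t).1 (h t).2 (ltn_ord _) (ltn_ord _).
  by rewrite /y !inord_val -surjective_pairing hK.
apply/row_subP => l; apply/sub_kermxP/eqP/kerP; rewrite rowE.
have := periodic_balanced (n := n.+1) (r := r.+1)
  (fun k => Dper (delta_mx 0 l) _ k sn) (fun k => Dper (delta_mx 0 l) _ k sr).
move=> De a i an ir; have := De a i an ir.
have yE b j : (b < n.+1)%N -> (j < r.+1)%N -> y (delta_mx 0 l *m T) b j =
    D (delta_mx 0 l) (n.+1 + j - b).+1 - D (delta_mx 0 l) (n.+1 + j - b)%N.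
  by move=> bn jr; rewrite /y eT /pos gK /= !inordK.
have box u v w x : (v <= n.+1)%N -> (x <= r.+1)%N ->
    \sum_(u <= b < v) \sum_(w <= j < x) y (delta_mx 0 l *m T) b j =
    \sum_(u <= b < v) \sum_(w <= j < x)
      (D (delta_mx 0 l) (n.+1 + j - b).+1 - D (delta_mx 0 l) (n.+1 + j - b)%N).
  by move=> vn xr; apply: eq_big_nat => b bv; apply: eq_big_nat => j jx; apply: yE; lia.
by rewrite !box.
Qed.

(** * Entries of the two block matrices *)

Lemma H_entry n r (A M : 'M[int]_r) (a b : 'I_n) (i j : 'I_r) :
  H n A M (tagnat.Rank a i) (tagnat.Rank b j) =
  (if a == b then A else if (a < b)%N then M else - M^T) i j.
Proof.
(* All blocks have the same size, so the cast left by [tagnat.Rank2K] disappears on underlying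
   values. *)
have sig2E (c : 'I_n) (k : 'I_r) :
    tagnat.sig2 (tagnat.Rank (p_ := fun=> r) c k) = k :> 'I_r.
  by rewrite tagnat.Rank2K; apply: val_inj.
by rewrite /H mxE !tagnat.Rank1K !sig2E.
Qed.

Lemma H_II_entry n r (a b : 'I_n) (i j : 'I_r) :
  H_II n r (tagnat.Rank a i) (tagnat.Rank b j) =
  ((b <= a)%N && (j <= i)%N)%:R - ((a <= b)%N && (i <= j)%N)%:R.
Proof.
rewrite /H_II H_entry -val_eqE.
by case: (ltngtP a b) => _; rewrite !mxE; case: (ltngtP i j).
Qed.

Lemma H_I_entry n r (a b : 'I_n) (i j : 'I_r) :
  H_I n r (tagnat.Rank a i) (tagnat.Rank b j) =
  ((a <= b)%N && (j <= i)%N)%:R - ((b <= a)%N && (i <= j)%N)%:R.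
Proof.
rewrite /H_I H_entry -val_eqE.
by case: (ltngtP a b) => _; rewrite !mxE; case: (ltngtP i j).
Qed.

Lemma block_index_bij n r :
  bijective (fun p : 'I_n * 'I_r => tagnat.Rank (p_ := fun=> r) p.1 p.2).
Proof.
exists (fun t : 'I_(\sum_(i < n) r) => (tagnat.sig1 t, tagnat.sig2 t : 'I_r)) => [[a i]|t] /=.
  by rewrite tagnat.Rank1K tagnat.Rank2K; congr (_, _); apply: val_inj.
exact: tagnat.sig2K.
Qed.

Theorem proposition3p6 (n r : nat) (hn : (1 <= n)%N) (hr : (1 <= r)%N) :
  let s := gcdn (n + 1) (r + 1) in
  corank (H_I n r) = (s - 1)%N /\ (s - 1)%N = corank (H_II n r).
Proof.
rewrite /= !addn1 subn1; split.
  (* Reversing the blocks swaps a <= b with b <= a, which gives [H_I] the entries of [H_II]. *)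
  pose rev1 (p : 'I_n * 'I_r) := (rev_ord p.1, p.2).
  have rev1K : involutive rev1 by move=> [a i]; rewrite /rev1 /= rev_ordK.
  apply: (corank_quadrants hn hr (bij_comp (block_index_bij n r) (inv_bij rev1K))).
  move=> a b i j; rewrite /= H_I_entry /=.
  by congr ((_ && _)%:R - (_ && _)%:R); have := ltn_ord a; have := ltn_ord b; lia.
apply/esym/(corank_quadrants hn hr (block_index_bij n r)) => a b i j.
exact: H_II_entry.
Qed.
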